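(* $$\sum_{k=1}^\infty\frac{2^k}{k^2\binom{2k}{k}}\left(2S_1(2k)-3S_1(k)+\frac2k\right)=\frac74\zeta_3.$$
   Context: $S_1(n):=\sum_{i=1}^n \frac1i$ is the $n$-th harmonic number, and $\zeta_3:=\sum_{i=1}^\infty \frac{1}{i^3}$. *)

(* Defs.v *)
From Stdlib Require Import Reals.
From Coquelicot Require Import Coquelicot.
Open Scope R_scope.

Definition S1 (n : nat) : R := sum_n_m (fun i : nat => 1 / INR i) 1 n.

(* [Series] is indexed from 0, hence the shift of the index by one. *)
Definition zeta3 : R := Series (fun i : nat => 1 / INR (S i) ^ 3).

(* Main.v *)
Require Import Defs.
From Stdlib Require Import Reals.
From Coquelicot Require Import Coquelicot.
From Stdlib Require Import Lra Lia.
Open Scope R_scope.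

(** Write, for k >= 1,

      Q_k(y) = prod_(1 <= i < k) (i + y) / prod_(1 <= i <= k) (2 i - 1 + y).

    At y = 0 this is 2^k / (k binom(2k, k)), and its logarithmic derivative
    there is H_(k-1) - sum_(i <= k) 1 / (2 i - 1), which is
    - (2 S1(2k) - 3 S1(k) + 2 / k) / 2.  So the summand of the theorem is
    -2 Q_k'(0) / k, and with R_k(y) = y Q_k(y) it is -2 / k times the
    coefficient of e^2 in R_k(e).

    The series of R_k(y) / k can be moved from y to y + 2: since

      Q_(k+1)(y) = Q_k(y) (k + y) / (2 k + 1 + y)   and
      R_k(y + 2) = (k + 1 + y) Q_(k+1)(y),

    one gets the telescoping relation
    (R_k(y + 2) - R_k(y)) / k = Q_k(y) - Q_(k+1)(y).  (The sum of
    R_k(y) / k is the b-derivative at b = 0 of 2F1(y, b; (1 + y + b) / 2; 1/2),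
    which Gauss's second theorem evaluates by Gamma functions; hence the
    simple behaviour in y.)  Take the coefficient of e^2 at
    y + e, sum over k <= K, and then over y = 0, 2, ..., 2 (N - 1).
    As Q_1(y) = 1 / (1 + y), the result is that the coefficients r2 of R_k
    satisfy

      sum_(k <= K) r2(2 N) / k - sum_(k <= K) r2(0) / k
        = sum_(n < N) 1 / (2 n + 1)^3 - sum_(n < N) q2(2 n),

    the last q2 being taken at the index K + 1 ([shifted_sum_iterated_shift]).
    The bounds |q2| <= 6 / ((1 + y)^2 (k + y)) and |r2| <= 8 / ((1 + y) k),
    from [q2_bound] and [r2_bound], hold uniformly in k and y, so that for
    K = N both unwanted sums are O(1 / N), by comparison with the sum of
    1 / i^2.  Hence the sum of r2(0) / k is minus the sum of the inverse odd
    cubes, which is - (7 / 8) zeta3. *)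

(** * Taylor coefficients of the products *)

(** [q0 y j], [q1 y j], [q2 y j] are the coefficients of 1, e, e^2 in
    Q_k(y + e) with k = j + 1.  They are computed by comparing coefficients in
    (2 k + 1 + y + e) Q_(k+1)(y + e) = (k + y + e) Q_k(y + e).  In the
    successor case [S i] is the index k of the old product. *)
Fixpoint q0 (y : R) (j : nat) : R :=
  match j with
  | O => 1 / (1 + y)
  | S i => (INR (S i) + y) * q0 y i / (2 * INR (S i) + 1 + y)
  end.

Fixpoint q1 (y : R) (j : nat) : R :=
  match j with
  | O => - (1 / (1 + y) ^ 2)
  | S i => ((INR (S i) + y) * q1 y i + q0 y i - q0 y (S i))
             / (2 * INR (S i) + 1 + y)
  end.

Fixpoint q2 (y : R) (j : nat) : R :=
  match j with
  | O => 1 / (1 + y) ^ 3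
  | S i => ((INR (S i) + y) * q2 y i + q1 y i - q1 y (S i))
             / (2 * INR (S i) + 1 + y)
  end.

(** The coefficient of e^2 in R_k(y + e) = (y + e) Q_k(y + e), k = j + 1. *)
Definition r2 (y : R) (j : nat) : R := y * q2 y j + q1 y j.

Lemma q0_S (y : R) (j : nat) :
  q0 y (S j) = (INR (S j) + y) * q0 y j / (2 * INR (S j) + 1 + y).
Proof. reflexivity. Qed.

Lemma q1_S (y : R) (j : nat) :
  q1 y (S j) = ((INR (S j) + y) * q1 y j + q0 y j - q0 y (S j))
                 / (2 * INR (S j) + 1 + y).
Proof. reflexivity. Qed.

Lemma q2_S (y : R) (j : nat) :
  q2 y (S j) = ((INR (S j) + y) * q2 y j + q1 y j - q1 y (S j))
                 / (2 * INR (S j) + 1 + y).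
Proof. reflexivity. Qed.

(** * The shift of y by two *)

(** This and the next two lemmas compare the coefficients of 1, e, e^2 in
    (y + 2 + e) Q_k(y + 2 + e) = (k + 1 + y + e) Q_(k+1)(y + e).  Both sides
    satisfy the same recursion in k. *)
Lemma q0_shift (y : R) (j : nat) : 0 <= y ->
  q0 (y + 2) j = (INR j + 2 + y) * q0 y (S j) / (y + 2).
Proof.
intros Hy; induction j as [|j IH].
- simpl; field; lra.
- pose proof (pos_INR j).
  rewrite q0_S, IH, (q0_S y (S j)), !S_INR; field; lra.
Qed.

Lemma q1_shift (y : R) (j : nat) : 0 <= y ->
  q1 (y + 2) j =
  ((INR j + 2 + y) * q1 y (S j) + q0 y (S j) - q0 (y + 2) j) / (y + 2).
Proof.
intros Hy; induction j as [|j IH].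
- simpl; field; lra.
- pose proof (pos_INR j).
  rewrite q1_S, IH, (q1_S y (S j)), !q0_shift by lra.
  rewrite (q0_S y (S j)), !S_INR; field; lra.
Qed.

Lemma q2_shift (y : R) (j : nat) : 0 <= y ->
  q2 (y + 2) j =
  ((INR j + 2 + y) * q2 y (S j) + q1 y (S j) - q1 (y + 2) j) / (y + 2).
Proof.
intros Hy; induction j as [|j IH].
- simpl; field; lra.
- pose proof (pos_INR j).
  rewrite q2_S, IH, (q2_S y (S j)), !q1_shift, !q0_shift by lra.
  rewrite (q1_S y (S j)), (q0_S y (S j)), !S_INR; field; lra.
Qed.

(** The telescoping relation (R_k(y + 2) - R_k(y)) / k = Q_k(y) - Q_(k+1)(y):
    by the shift formula, R_k(y + 2) - R_k(y) is
    (k + 1 + y) Q_(k+1) - y Q_k, and replacing (2 k + 1 + y) Q_(k+1) by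
    (k + y) Q_k turns this into k (Q_k - Q_(k+1)). *)
Lemma r2_shift (y : R) (j : nat) : 0 <= y ->
  (r2 (y + 2) j - r2 y j) / INR (S j) = q2 y j - q2 y (S j).
Proof.
intros Hy; pose proof (pos_INR j).
unfold r2; rewrite q2_shift, q2_S, !S_INR by lra; field; lra.
Qed.

(** * Uniform bounds *)

(** The bound c / (k + y) reproduces itself under the recursion, with room to
    spare: the homogeneous part yields c / (2 k + 1 + y), and the difference
    to c / (k + 1 + y) absorbs an increment d of the stated size. *)
Lemma recursion_bound (k y c x d : R) : 1 <= k -> 0 <= y ->
  Rabs x <= c / (k + y) -> Rabs d <= c * k / (k + 1 + y) ->
  Rabs (((k + y) * x + d) / (2 * k + 1 + y)) <= c / (k + 1 + y).
Proof.
intros Hk Hy Hx Hd.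
rewrite Rabs_div, (Rabs_pos_eq (2 * k + 1 + y)) by lra.
apply Rle_div_l; [lra|].
apply Rle_trans with (c + c * k / (k + 1 + y)); [|right; field; lra].
eapply Rle_trans; [apply Rabs_triang|].
apply Rplus_le_compat; [|exact Hd].
rewrite Rabs_mult, Rabs_pos_eq by lra.
apply Rle_trans with ((k + y) * (c / (k + y))); [|right; field; lra].
apply Rmult_le_compat_l; lra.
Qed.

Lemma q0_bound (y : R) (j : nat) : 0 <= y ->
  Rabs (q0 y j) <= 1 / (INR (S j) + y).
Proof.
intros Hy; induction j as [|j IH].
- simpl; rewrite Rabs_pos_eq; [lra|apply Rlt_le, Rdiv_lt_0_compat; lra].
- pose proof (pos_INR j).
  rewrite q0_S, (S_INR (S j)).
  (* This is [recursion_bound] with the increment d equal to 0. *)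
  rewrite <- (Rplus_0_r ((INR (S j) + y) * q0 y j)).
  rewrite S_INR in *.
  apply recursion_bound; try lra.
  rewrite Rabs_R0; apply Rdiv_le_0_compat; lra.
Qed.

(** The increment in the recursion for [q1].  The difference is
    (k + 1) q0 / (2 k + 1 + y), where k + 1 <= 2 k and 1 / (k + y) is bounded
    by 1 / (1 + y); the factor 1 / (1 + y) becomes the gain of [q1] over
    [q0]. *)
Lemma q0_diff_bound (y : R) (j : nat) : 0 <= y ->
  Rabs (q0 y j - q0 y (S j)) <= 2 / (1 + y) * INR (S j) / (INR (S j) + 1 + y).
Proof.
intros Hy; pose proof (pos_INR j); pose proof (q0_bound y j Hy) as Hq.
rewrite q0_S; rewrite S_INR in *.
set (k := INR j + 1) in *.
assert (Hk : 1 <= k) by (unfold k; lra).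
replace (q0 y j - (k + y) * q0 y j / (2 * k + 1 + y))
  with ((k + 1) * (q0 y j * / (2 * k + 1 + y)))
  by (field; lra).
replace (2 / (1 + y) * k / (k + 1 + y))
  with (2 * k * (1 / (1 + y) * / (k + 1 + y))) by (field; lra).
assert (Hi : 0 < / (2 * k + 1 + y)) by (apply Rinv_0_lt_compat; lra).
rewrite !Rabs_mult, (Rabs_pos_eq (k + 1)), (Rabs_pos_eq (/ _))
  by lra.
apply Rmult_le_compat; [lra| |lra|].
- apply Rmult_le_pos; [apply Rabs_pos|lra].
- apply Rmult_le_compat; [apply Rabs_pos|lra| |].
  + eapply Rle_trans; [exact Hq|].
    apply Rmult_le_compat_l; [lra|apply Rinv_le_contravar; lra].
  + apply Rinv_le_contravar; lra.
Qed.

Lemma q1_bound (y : R) (j : nat) : 0 <= y ->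
  Rabs (q1 y j) <= 2 / (1 + y) / (INR (S j) + y).
Proof.
intros Hy; induction j as [|j IH].
- simpl.
  rewrite Rabs_Ropp, Rabs_pos_eq by (apply Rlt_le, Rdiv_lt_0_compat; nra).
  apply Rminus_le_0.
  replace (2 / (1 + y) / (1 + y) - 1 / ((1 + y) * ((1 + y) * 1)))
    with (1 / ((1 + y) * (1 + y))) by (field; lra).
  apply Rlt_le, Rdiv_lt_0_compat; nra.
- pose proof (pos_INR j); pose proof (q0_diff_bound y j Hy).
  rewrite q1_S, (S_INR (S j)).
  unfold Rminus; rewrite Rplus_assoc.
  apply recursion_bound; try assumption.
  rewrite S_INR; lra.
Qed.

(** The increment in the recursion for [q2].  The difference is
    ((k + 1) q1 - d) / (2 k + 1 + y), d being the difference for [q0]; the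
    constant is 6 = 4 + 2, with 4 from (k + 1) q1 and 2 from d. *)
Lemma q1_diff_bound (y : R) (j : nat) : 0 <= y ->
  Rabs (q1 y j - q1 y (S j))
  <= 6 / (1 + y) ^ 2 * INR (S j) / (INR (S j) + 1 + y).
Proof.
intros Hy; pose proof (pos_INR j).
pose proof (q0_diff_bound y j Hy) as Hd; pose proof (q1_bound y j Hy) as Hq.
rewrite q1_S.
set (d := q0 y j - q0 y (S j)) in *.
replace (q1 y j - ((INR (S j) + y) * q1 y j + q0 y j - q0 y (S j))
                    / (2 * INR (S j) + 1 + y))
  with (((INR (S j) + 1) * q1 y j + - d) / (2 * INR (S j) + 1 + y))
  by (unfold d; rewrite S_INR; field; lra).
rewrite S_INR in *.
set (k := INR j + 1) in *.
assert (Hk : 1 <= k) by (unfold k; lra).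
set (e := / (1 + y)).
assert (He : 0 < e) by (apply Rinv_0_lt_compat; lra).
assert (Hi1 : / (k + y) <= e) by (apply Rinv_le_contravar; lra).
assert (Hi2 : / (k + 1 + y) <= e) by (apply Rinv_le_contravar; lra).
assert (H2e : 0 <= 2 * e) by lra.
assert (Hq' : Rabs (q1 y j) <= 2 * e * e).
{ eapply Rle_trans; [exact Hq|].
  unfold Rdiv; fold e; apply Rmult_le_compat_l; assumption. }
assert (Hd' : Rabs d <= 2 * e * k * e).
{ eapply Rle_trans; [exact Hd|].
  unfold Rdiv; fold e; apply Rmult_le_compat_l; [nra|assumption]. }
assert (Hn : Rabs ((k + 1) * q1 y j + - d) <= 6 * e ^ 2 * k).
{ eapply Rle_trans; [apply Rabs_triang|].
  rewrite Rabs_Ropp, Rabs_mult, (Rabs_pos_eq (k + 1)) by lra.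
  apply Rle_trans with (2 * k * (2 * e * e) + 2 * e * k * e);
    [|right; ring].
  apply Rplus_le_compat; [|assumption].
  apply Rmult_le_compat; [lra|apply Rabs_pos|lra|assumption]. }
replace (6 / (1 + y) ^ 2) with (6 * e ^ 2) by (unfold e; field; lra).
rewrite Rabs_div, (Rabs_pos_eq (2 * k + 1 + y)) by lra.
apply Rmult_le_compat; [apply Rabs_pos| |assumption|].
- apply Rlt_le, Rinv_0_lt_compat; lra.
- apply Rinv_le_contravar; lra.
Qed.

Lemma q2_bound (y : R) (j : nat) : 0 <= y ->
  Rabs (q2 y j) <= 6 / (1 + y) ^ 2 / (INR (S j) + y).
Proof.
intros Hy; induction j as [|j IH].
- simpl.
  assert (0 < (1 + y) * ((1 + y) * ((1 + y) * 1)))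
    by (repeat apply Rmult_lt_0_compat; lra).
  rewrite Rabs_pos_eq by (apply Rlt_le, Rdiv_lt_0_compat; lra).
  apply Rminus_le_0.
  replace (_ - _) with (5 / ((1 + y) * ((1 + y) * ((1 + y) * 1))))
    by (field; lra).
  apply Rlt_le, Rdiv_lt_0_compat; lra.
- pose proof (pos_INR j); pose proof (q1_diff_bound y j Hy).
  rewrite q2_S, (S_INR (S j)).
  unfold Rminus; rewrite Rplus_assoc.
  apply recursion_bound; try assumption.
  rewrite S_INR; lra.
Qed.

Lemma r2_bound (y : R) (j : nat) : 0 <= y ->
  Rabs (r2 y j) <= 8 / (1 + y) / INR (S j).
Proof.
intros Hy; pose proof (pos_INR j).
pose proof (q1_bound y j Hy) as H1; pose proof (q2_bound y j Hy) as H2.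
rewrite S_INR in *.
set (k := INR j + 1) in *.
assert (Hk : 1 <= k) by (unfold k; lra).
unfold r2.
apply Rle_trans with
  ((1 + y) * (6 / (1 + y) ^ 2 / (k + y)) + 2 / (1 + y) / (k + y)).
- eapply Rle_trans; [apply Rabs_triang|].
  apply Rplus_le_compat; [|exact H1].
  rewrite Rabs_mult, (Rabs_pos_eq y) by lra.
  apply Rmult_le_compat; [lra|apply Rabs_pos|lra|exact H2].
- replace (_ + _) with (8 / (1 + y) * / (k + y)) by (field; lra).
  apply Rmult_le_compat_l; [apply Rlt_le, Rdiv_lt_0_compat; lra|].
  apply Rinv_le_contravar; lra.
Qed.

(** * Summation of the shift relation *)

Definition shifted_sum (y : R) (n : nat) : R :=
  sum_f_R0 (fun j => r2 y j / INR (S j)) n.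

Lemma shifted_sum_shift (y : R) (n : nat) : 0 <= y ->
  shifted_sum (y + 2) n - shifted_sum y n = 1 / (1 + y) ^ 3 - q2 y (S n).
Proof.
intros Hy; change (1 / (1 + y) ^ 3) with (q2 y 0).
unfold shifted_sum; induction n as [|n IH].
- simpl sum_f_R0; rewrite <- r2_shift by assumption; simpl; field.
- pose proof (pos_INR n).
  pose proof (r2_shift y (S n) Hy) as Hs.
  rewrite !tech5.
  replace (q2 y 0 - q2 y (S (S n)))
    with ((q2 y 0 - q2 y (S n)) + (q2 y (S n) - q2 y (S (S n)))) by ring.
  rewrite <- IH, <- Hs; unfold Rdiv; ring.
Qed.

Lemma shifted_sum_iterated_shift (n m : nat) :
  shifted_sum (2 * INR (S m)) n - shifted_sum 0 n =
  sum_f_R0 (fun i => 1 / (2 * INR i + 1) ^ 3) m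
  - sum_f_R0 (fun i => q2 (2 * INR i) (S n)) m.
Proof.
induction m as [|m IH].
- replace (2 * INR 1) with (0 + 2) by (simpl; ring).
  rewrite shifted_sum_shift by lra; simpl sum_f_R0.
  change (INR 0) with 0; rewrite Rmult_0_r, (Rplus_comm 1 0); reflexivity.
- pose proof (pos_INR (S m)).
  rewrite !tech5.
  replace (2 * INR (S (S m))) with (2 * INR (S m) + 2)
    by (rewrite (S_INR (S m)); ring).
  pose proof (shifted_sum_shift (2 * INR (S m)) n ltac:(lra)) as Hs.
  rewrite (Rplus_comm 1) in Hs.
  lra.
Qed.

Lemma sum_inv_sq_bound (n : nat) :
  sum_f_R0 (fun i => 1 / INR (S i) ^ 2) n <= 2.
Proof.
apply Rle_trans with (2 - 1 / INR (S n));
  [|pose proof (pos_INR n); rewrite S_INR;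
    assert (0 < 1 / (INR n + 1)) by (apply Rdiv_lt_0_compat; lra); lra].
induction n as [|n IH]; [simpl; lra|].
pose proof (pos_INR n).
rewrite tech5.
apply Rle_trans with (2 - 1 / INR (S n) + 1 / INR (S (S n)) ^ 2); [lra|].
rewrite !S_INR.
apply Rminus_le_0.
replace (_ - _) with (1 / ((INR n + 1) * (INR n + 1 + 1) ^ 2))
  by (field; lra).
apply Rlt_le, Rdiv_lt_0_compat; [lra|].
apply Rmult_lt_0_compat; [lra|apply pow_lt; lra].
Qed.

Lemma sum_inv_sq_dominated (f : nat -> R) (c : R) (n : nat) : 0 <= c ->
  (forall i, Rabs (f i) <= c * (1 / INR (S i) ^ 2)) ->
  Rabs (sum_f_R0 f n) <= 2 * c.
Proof.
intros Hc Hf.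
eapply Rle_trans; [apply Rsum_abs|].
eapply Rle_trans; [apply sum_Rle; intros i _; apply Hf|].
replace (sum_f_R0 _ n) with (c * sum_f_R0 (fun i => 1 / INR (S i) ^ 2) n)
  by (rewrite scal_sum; apply sum_eq; intros; ring).
rewrite (Rmult_comm 2 c).
apply Rmult_le_compat_l; [assumption|apply sum_inv_sq_bound].
Qed.

(** The number of shifts equals the number of terms: the shifted sum
    contributes 16 / (n + 1) and the boundary terms 12 / (n + 1). *)
Lemma shifted_sum_zero_estimate (n : nat) :
  Rabs (shifted_sum 0 n + sum_f_R0 (fun i => 1 / (2 * INR i + 1) ^ 3) n)
  <= 28 * / INR (S n).
Proof.
pose proof (shifted_sum_iterated_shift n n) as Hs.
pose proof (pos_INR n).
assert (Hi : 0 < / INR (S n)) by (apply Rinv_0_lt_compat; rewrite S_INR; lra).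
assert (HT : Rabs (shifted_sum (2 * INR (S n)) n) <= 2 * (8 * / INR (S n))).
{ apply sum_inv_sq_dominated; [lra|]; intros i.
  pose proof (pos_INR i).
  pose proof (r2_bound (2 * INR (S n)) i) as Hr.
  rewrite Rabs_div, (Rabs_pos_eq (INR (S i)))
    by (rewrite S_INR; lra).
  apply Rle_trans with (8 * / INR (S n) / INR (S i) / INR (S i));
    [|right; field; rewrite !S_INR; lra].
  rewrite !S_INR in *.
  apply Rmult_le_compat_r; [apply Rlt_le, Rinv_0_lt_compat; lra|].
  eapply Rle_trans; [apply Hr; lra|].
  apply Rmult_le_compat_r; [apply Rlt_le, Rinv_0_lt_compat; lra|].
  apply Rmult_le_compat_l; [lra|apply Rinv_le_contravar; lra]. }
assert (HQ : Rabs (sum_f_R0 (fun i => q2 (2 * INR i) (S n)) n)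
             <= 2 * (6 * / INR (S n))).
{ apply sum_inv_sq_dominated; [lra|]; intros i.
  pose proof (pos_INR i).
  eapply Rle_trans; [apply q2_bound; lra|].
  apply Rle_trans with (6 / INR (S i) ^ 2 * / INR (S n));
    [|right; field; rewrite !S_INR; lra].
  rewrite !S_INR in *.
  apply Rmult_le_compat.
  - apply Rlt_le, Rdiv_lt_0_compat; [lra|apply pow_lt; lra].
  - apply Rlt_le, Rinv_0_lt_compat; lra.
  - apply Rmult_le_compat_l; [lra|].
    apply Rinv_le_contravar; [apply pow_lt; lra|apply pow_incr; lra].
  - apply Rinv_le_contravar; lra. }
replace (shifted_sum 0 n + sum_f_R0 (fun i => 1 / (2 * INR i + 1) ^ 3) n)
  with (shifted_sum (2 * INR (S n)) n
        + sum_f_R0 (fun i => q2 (2 * INR i) (S n)) n) by lra.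
eapply Rle_trans; [apply Rabs_triang|]; lra.
Qed.

(** * The inverse odd cubes *)

Lemma zeta3_lim :
  is_lim_seq (sum_f_R0 (fun i => 1 / INR (S i) ^ 3)) zeta3.
Proof.
apply is_lim_seq_ext with (sum_n (fun i => 1 / INR (S i) ^ 3));
  [apply sum_n_Reals|].
apply (Series_correct (fun i => 1 / INR (S i) ^ 3)).
assert (Hc : forall i, 0 < 1 / INR (S i) ^ 3 <= 1 / INR (S i) ^ 2).
{ intros i; pose proof (pos_INR i); rewrite S_INR.
  split; [apply Rdiv_lt_0_compat; [lra|apply pow_lt; lra]|].
  apply Rmult_le_compat_l; [lra|].
  apply Rinv_le_contravar; [apply pow_lt; lra|].
  apply Rle_pow; [lra|lia]. }
destruct (ex_finite_lim_seq_incr (sum_n (fun i => 1 / INR (S i) ^ 3)) 2)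
  as [l Hl].
- intros n; rewrite !sum_n_Reals, tech5; specialize (Hc (S n)); lra.
- intros n; rewrite sum_n_Reals.
  eapply Rle_trans; [|apply (sum_inv_sq_bound n)].
  apply sum_Rle; intros i _; apply Hc.
- exists l; exact Hl.
Qed.

Lemma odd_cubes_split (n : nat) :
  sum_f_R0 (fun i => 1 / (2 * INR i + 1) ^ 3) n =
  sum_f_R0 (fun i => 1 / INR (S i) ^ 3) (2 * n + 1)
  - 1 / 8 * sum_f_R0 (fun i => 1 / INR (S i) ^ 3) n.
Proof.
induction n as [|n IH]; [simpl; field|].
pose proof (pos_INR n).
replace (2 * S n + 1)%nat with (S (S (2 * n + 1))) by lia.
rewrite !tech5, IH.
replace (INR (S (S (2 * n + 1)))) with (2 * INR (S n) + 1)
  by (rewrite !S_INR, plus_INR, mult_INR; simpl; ring).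
replace (INR (S (S (S (2 * n + 1))))) with (2 * INR (S (S n)))
  by (rewrite !S_INR, plus_INR, mult_INR; simpl; ring).
rewrite !S_INR; field; lra.
Qed.

Lemma odd_cubes_lim :
  is_lim_seq (sum_f_R0 (fun i => 1 / (2 * INR i + 1) ^ 3)) (7 / 8 * zeta3).
Proof.
apply is_lim_seq_ext with
  (fun n => sum_f_R0 (fun i => 1 / INR (S i) ^ 3) (2 * n + 1)
            - 1 / 8 * sum_f_R0 (fun i => 1 / INR (S i) ^ 3) n);
  [intros n; symmetry; apply odd_cubes_split|].
replace (7 / 8 * zeta3) with (zeta3 - 1 / 8 * zeta3) by field.
apply is_lim_seq_minus'.
- apply (is_lim_seq_subseq _ _ (fun n => (2 * n + 1)%nat)); [|apply zeta3_lim].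
  apply eventually_subseq; intros n; lia.
- apply (is_lim_seq_scal_l _ (1 / 8) zeta3), zeta3_lim.
Qed.

Lemma shifted_sum_zero_lim : is_lim_seq (shifted_sum 0) (- (7 / 8 * zeta3)).
Proof.
set (o := sum_f_R0 (fun i => 1 / (2 * INR i + 1) ^ 3)).
apply is_lim_seq_ext with (fun n => (shifted_sum 0 n + o n) - o n);
  [intros n; ring|].
replace (- (7 / 8 * zeta3)) with (0 - 7 / 8 * zeta3) by ring.
apply is_lim_seq_minus'; [|apply odd_cubes_lim].
apply is_lim_seq_abs_0.
apply is_lim_seq_le_le with (fun _ => 0) (fun n => 28 * / INR (S n)).
- intros n; split; [apply Rabs_pos|apply shifted_sum_zero_estimate].
- apply is_lim_seq_const.
- replace 0 with (28 * 0) by ring.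
  apply (is_lim_seq_scal_l _ 28 0).
  apply (is_lim_seq_incr_1 (fun n => / INR n)).
  apply (is_lim_seq_inv _ p_infty); [apply is_lim_seq_INR|discriminate].
Qed.

(** * The summand as a Taylor coefficient *)

Lemma S1_S (n : nat) : S1 (S n) = S1 n + 1 / INR (S n).
Proof. unfold S1; rewrite sum_n_Sm by lia; reflexivity. Qed.

Lemma S1_1 : S1 1 = 1.
Proof. unfold S1; rewrite sum_n_n; simpl; field. Qed.

Lemma central_binomial_S (k : nat) :
  Binomial.C (2 * S k) (S k) =
  Binomial.C (2 * k) k * (2 * (2 * INR k + 1)) / (INR k + 1).
Proof.
pose proof (pos_INR k).
unfold Binomial.C.
replace (2 * S k - S k)%nat with (S k) by lia.
replace (2 * k - k)%nat with k by lia.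
replace (2 * S k)%nat with (S (S (2 * k))) by lia.
rewrite !fact_simpl, !mult_INR, !S_INR, mult_INR.
change (INR 2) with 2.
pose proof (INR_fact_neq_0 k).
field; lra.
Qed.

Lemma central_binomial_pos (k : nat) : 0 < Binomial.C (2 * k) k.
Proof.
unfold Binomial.C; apply Rdiv_lt_0_compat;
  [|apply Rmult_lt_0_compat]; apply INR_fact_lt_0.
Qed.

Lemma q0_zero (j : nat) :
  q0 0 j = 2 ^ S j / (INR (S j) * Binomial.C (2 * S j) (S j)).
Proof.
induction j as [|j IH].
- unfold Binomial.C; simpl; field.
- pose proof (pos_INR j); pose proof (central_binomial_pos (S j)).
  rewrite q0_S, IH, (central_binomial_S (S j)).
  rewrite <- (tech_pow_Rmult 2 (S j)), (S_INR (S j)), !S_INR in *.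
  field; lra.
Qed.

(** The last factor is -2 times the logarithmic derivative of Q_k at 0. *)
Lemma q1_zero (j : nat) :
  q1 0 j = - (q0 0 j * (2 * S1 (2 * S j) - 3 * S1 (S j) + 2 / INR (S j)) / 2).
Proof.
induction j as [|j IH].
- change (2 * 1)%nat with 2%nat; rewrite S1_S, S1_1; simpl; field.
- pose proof (pos_INR j).
  rewrite q1_S, IH, q0_S.
  replace (2 * S (S j))%nat with (S (S (2 * S j))) by lia.
  rewrite (S1_S (S (2 * S j))), (S1_S (2 * S j)), (S1_S (S j)).
  rewrite (S_INR (S (2 * S j))), (S_INR (2 * S j)), mult_INR, !S_INR.
  change (INR 0) with 0.
  field; lra.
Qed.

(* Stdlib reals with Coquelicot series.  [Binomial.C] is the binomial
   coefficient (the unqualified [C] is Coquelicot's type of complex numbers);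
   [is_series] is indexed from 0, hence k := S j. *)
Theorem mainTheorem9 :
  is_series
    (fun j : nat =>
       let k := S j in
       2 ^ k / (INR k ^ 2 * Binomial.C (2 * k) k)
         * (2 * S1 (2 * k) - 3 * S1 k + 2 / INR k))
    (7 / 4 * zeta3).
Proof.
apply (is_lim_seq_ext (fun n => -2 * shifted_sum 0 n) _ (7 / 4 * zeta3)).
- intros n; rewrite sum_n_Reals; unfold shifted_sum; rewrite scal_sum.
  apply sum_eq; intros j _; cbv zeta.
  pose proof (pos_INR j); pose proof (central_binomial_pos (S j)).
  unfold r2; rewrite q1_zero, q0_zero.
  field; rewrite S_INR; lra.
- replace (7 / 4 * zeta3) with (-2 * - (7 / 8 * zeta3)) by field.
  apply (is_lim_seq_scal_l _ (-2) (- (7 / 8 * zeta3))), shifted_sum_zero_lim.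
Qed.
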